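(* Let $p$ be a prime, $N=p^e$ with $e\ge1$, and let $Q=p^m$ with $m\ge1$. Assume $\mathbb F_N\subseteq\mathbb F_Q$. Then $$\Lambda_N(U)=U(U-1)^{N-1}\in\mathbb F_p[U]$$ is not a permutation polynomial of $\mathbb F_Q$, and $$\#\Lambda_N(\mathbb F_Q)=Q-\frac QN=Q-\left\lceil\frac{Q-1}{N}\right\rceil.$$ Thus $\Lambda_N$ attains the Wan--Shiue--Chen upper bound over every finite field containing $\mathbb F_N$.
   Context: All finite fields of characteristic $p$ are regarded as subfields of a fixed algebraic closure $\overline{\mathbb F}_p$, so $\mathbb F_N\subseteq\mathbb F_Q$ means $e\mid m$. A polynomial is a permutation polynomial of $\mathbb F_Q$ if it induces a bijection of $\mathbb F_Q$. $\Lambda_N(\mathbb F_Q)$ denotes the image of $\Lambda_N$ on $\mathbb F_Q$. The Wan--Shiue--Chen upper bound is the known inequality $\#f(\mathbb F_Q)\le Q-\lceil (Q-1)/d\rceil$ for a polynomial $f\in\mathbb F_Q[U]$ of degree $d$ that is not a permutation polynomial of $\mathbb F_Q$. *)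

(* Defs.v *)
From HB Require Import structures.
From mathcomp Require Import all_boot all_order all_algebra all_field.

Set Implicit Arguments.
Unset Strict Implicit.
Unset Printing Implicit Defensive.

Import Order.TTheory GRing.Theory Num.Theory.
Local Open Scope ring_scope.

(* The inclusion of the prime field: when p is prime and R has characteristic
   p, this is the unique ring morphism from 'F_p to R. *)
Definition prime_incl (p : nat) (R : nzRingType) (x : 'F_p) : R :=
  (x : nat)%:R.

Definition base_change (p : nat) (R : nzRingType) (f : {poly 'F_p}) : {poly R} :=
  map_poly (@prime_incl p R) f.

Definition permutation_poly (F : finFieldType) (f : {poly F}) : Prop :=
  bijective (fun u : F => f.[u]).

Definition value_set (F : finFieldType) (f : {poly F}) : {set F} :=
  [set f.[u] | u : F].

Definition degree (R : nzRingType) (f : {poly R}) : nat := (size f).-1.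

Definition wan_shiue_chen_bound (Q d : nat) : rat :=
  Q%:R - (Num.ceil ((Q%:R - 1) / d%:R : rat))%:~R.

(* The bound only concerns polynomials that do not permute F, so attaining it
   includes not being a permutation polynomial. *)
Definition attains_wan_shiue_chen (F : finFieldType) (f : {poly F}) : Prop :=
  ~ permutation_poly f /\
  #|value_set f|%:R = wan_shiue_chen_bound #|F| (degree f).

Definition Lambda (p N : nat) : {poly 'F_p} := 'X * ('X - 1) ^+ (N - 1).

(* iota makes L an algebraic closure of 'F_p: L is algebraically closed by its
   type, and integralRange says that it is algebraic over the image of iota. *)
Definition is_algebraic_closure (p : nat) (L : closedFieldType)
    (iota : {rmorphism 'F_p -> L}) : Prop :=
  integralRange iota.

(* Containment, inside the common overfield L, of the subfields that are the
   images of the embeddings i and j. *)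
Definition subfield_contained (K F L : fieldType)
    (i : {rmorphism K -> L}) (j : {rmorphism F -> L}) : Prop :=
  forall x : K, exists y : F, i x = j y.

(* Main.v *)
Require Import Defs.
From HB Require Import structures.
From mathcomp Require Import all_boot all_order all_algebra all_field.
From mathcomp Require Import ring lra.

(* Write N = n + 1.  The Artin-Schreier map y |-> y^N - y is additive with
   kernel F_N, so its image I has Q/N elements.  For every r, the power r^n is
   a value of Lambda_N iff r lies in I, and every c that is not an n-th power is
   a value, because t |-> c t^N - t is then injective, hence onto.  So r |-> r^n
   maps the Q - Q/N = n Q/N elements outside I onto the set of missed values; its
   fibres are cosets of F_N^*, of size n, and Q/N values are missed. *)

Set Implicit Arguments.
Unset Strict Implicit.
Unset Printing Implicit Defensive.

Import Order.TTheory GRing.Theory Num.Theory.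
Local Open Scope ring_scope.

Lemma card_constant_fibers (T U : finType) (f : T -> U) (A : {pred T}) k :
  {in A, forall x, #|[set y in A | f y == f x]| = k} ->
  #|A| = (#|f @: A| * k)%N.
Proof.
move=> fibk; rewrite -sum1_card (partition_big_imset f) /=.
rewrite -sum_nat_const; apply: eq_bigr => _ /imsetP[x xA ->].
by rewrite sum1dep_card fibk.
Qed.

Lemma base_change_Lambda (F : finFieldType) p N :
  p \in [pchar F] -> base_change F (Lambda p N) = 'X * ('X - 1) ^+ (N - 1).
Proof.
move=> charFp; rewrite /base_change /Lambda.
(* [prime_incl] carries no morphism structure, so it is exchanged for the structure map of $F$ as an
   $\mathbb F_p$-algebra. *)
have -> : map_poly (@prime_incl p F) ('X * ('X - 1) ^+ (N - 1)) =
    map_poly (in_alg (pPrimeCharType charFp)) ('X * ('X - 1) ^+ (N - 1)).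
  by apply: eq_map_poly => x; rewrite /= [RHS]mulr1.
by rewrite rmorphM rmorphXn rmorphB /= map_polyX rmorph1.
Qed.

Section LambdaValues.

Variables (F : finFieldType) (n : nat).
Hypotheses (n_gt0 : (0 < n)%N)
  (frobB : {morph (fun x : F => x ^+ n.+1) : x y / x - y})
  (card_fixed : #|[set x : F | x ^+ n.+1 == x]| = n.+1).

Definition artin_schreier_image : {set F} := [set y ^+ n.+1 - y | y : F].

Definition Lambda_values : {set F} := [set u * (u - 1) ^+ n | u : F].

Lemma card_artin_schreier_image : #|F| = (#|artin_schreier_image| * n.+1)%N.
Proof.
apply: card_constant_fibers => x _.
rewrite -[RHS]card_fixed -[RHS](card_imset _ (addIr x)); apply: eq_card => y.
rewrite !inE /=; apply/eqP/imsetP => [eq_xy | [z + ->]].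
  exists (y - x); last by rewrite subrK.
  rewrite inE frobB; apply/eqP; rewrite -[y ^+ _](subrK y) eq_xy; ring.
rewrite inE => /eqP zE; have := frobB (z + x) x; rewrite addrK zE => zE'.
rewrite -[(z + x) ^+ _](subrK (x ^+ n.+1)) -zE'; ring.
Qed.

(** If $r = y^N - y = y(y^n - 1)$, then $u = y^n$ gives $u(u-1)^n = r^n$. Conversely, if $r \ne 0$
    and $r^n = u(u-1)^n$, then $y = r/(u-1)$ satisfies $y^n = u$, so $y^N - y = y(u-1) = r$. *)
Lemma mem_exp_Lambda_values r :
  (r ^+ n \in Lambda_values) = (r \in artin_schreier_image).
Proof.
apply/imsetP/imsetP => [[u _ rE] | [y _ ->]]; last first.
  exists (y ^+ n) => //.
  by rewrite -exprMn; congr (_ ^+ n); rewrite exprS; ring.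
have [r0 | r_neq0] := eqVneq r 0.
  by exists 0; rewrite // r0 expr0n subrr.
have u1_neq0 : u - 1 != 0.
  apply: contra_neq r_neq0 => u1; move/eqP: rE.
  by rewrite u1 expr0n eqn0Ngt n_gt0 mulr0 expf_eq0 n_gt0 => /eqP.
exists (r / (u - 1)) => //.
rewrite exprS expr_div_n rE; field.
by rewrite u1_neq0 expf_neq0.
Qed.

Lemma nonpower_Lambda_values c :
  c \notin [set r ^+ n | r : F] -> c \in Lambda_values.
Proof.
move=> c_nonpower; pose g t := c * t ^+ n.+1 - t.
have g_inj : injective g.
  (* A nonzero $d = x - y$ with $c d^N = d$ would make $c = (d^{-1})^n$ an $n$-th power. *)
  move=> x y gxy; apply/eqP; rewrite -subr_eq0; apply: contraNT c_nonpower.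
  move=> xy_neq0; apply/imsetP; exists (x - y)^-1 => //.
  have : c * (x - y) ^+ n.+1 = x - y.
    rewrite frobB mulrBr -[c * x ^+ _](subrK x) [_ - x]gxy /g; ring.
  rewrite exprS mulrCA -[RHS]mulr1 => /(mulfI xy_neq0) cE.
  by apply: (mulIf (expf_neq0 n xy_neq0)); rewrite cE exprVn mulVf ?expf_neq0.
(* Hitting the value 1 yields $c t^N = 1 + t$; dividing by $t^N$ gives $c = u(u-1)^n$ with $u = 1 +
   t^{-1}$. *)
have [t gt1] : exists t, g t = 1.
  by have [h _ hK] := injF_bij g_inj; exists (h 1); rewrite hK.
have t_neq0 : t != 0.
  apply/eqP => t0; move/eqP: gt1.
  by rewrite /g t0 exprS mul0r mulr0 subrr eq_sym oner_eq0.
have tE : c * t ^+ n.+1 = 1 + t by rewrite -gt1 /g subrK.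
apply/imsetP; exists (1 + t^-1) => //.
apply: (mulIf (expf_neq0 n.+1 t_neq0)); rewrite tE addrAC subrr add0r exprS.
by rewrite exprVn; field; rewrite t_neq0 expf_neq0.
Qed.

Lemma missed_Lambda_values :
  ~: Lambda_values = (fun r => r ^+ n) @: ~: artin_schreier_image.
Proof.
apply/setP=> c; apply/idP/imsetP => [|[r rA ->]]; last first.
  by rewrite inE mem_exp_Lambda_values -in_setC.
rewrite inE => cV.
have /imsetP[r _ cE] := contraR (@nonpower_Lambda_values c) cV.
by exists r => //; rewrite inE -mem_exp_Lambda_values -cE.
Qed.

Lemma card_missed_Lambda_values : #|F| = (#|~: Lambda_values| * n.+1)%N.
Proof.
have cardF := card_artin_schreier_image.
(* As $\#F = N \cdot \#I$, the complement of $I$ has $n \cdot \#I$ elements; cancelling $n$ leaves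
   as many missed values as elements of $I$. *)
suff cardA : #|~: artin_schreier_image| = (#|~: Lambda_values| * n)%N.
  rewrite cardF; congr (_ * _)%N; apply/eqP; rewrite -(eqn_pmul2r n_gt0) -cardA.
  by rewrite -(eqn_add2l #|artin_schreier_image|) cardsC cardF mulnS.
rewrite missed_Lambda_values; apply: card_constant_fibers => r rA.
have r_neq0 : r != 0.
  apply: contraTneq rA => ->; rewrite inE negbK; apply/imsetP.
  by exists 0; rewrite // expr0n subrr.
have card_units : #|[set x : F | x ^+ n.+1 == x] :\ 0| = n.
  by move: card_fixed; rewrite (cardsD1 0) inE expr0n eqxx add1n => -[].
rewrite -[RHS]card_units -[RHS](card_imset _ (mulfI r_neq0)); apply: eq_card => y.
rewrite inE; apply/andP/imsetP => [[yA /eqP eq_yr] | [z]].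
  exists (y / r); last by rewrite mulrC divfK.
  rewrite !inE exprS expr_div_n eq_yr divff ?expf_neq0 // mulr1 eqxx andbT.
  rewrite mulf_neq0 ?invr_eq0 //; apply: contraNneq r_neq0 => y0.
  by move/eqP: eq_yr; rewrite y0 expr0n eqn0Ngt n_gt0 eq_sym expf_eq0 n_gt0.
rewrite !inE exprS => /andP[z_neq0 /eqP zE] ->.
have zn1 : z ^+ n = 1 by apply: (mulfI z_neq0); rewrite zE mulr1.
rewrite exprMn zn1 mulr1 eqxx; split=> //.
(* Membership of $r$ in $I$ depends only on $r^n$, so the complement is stable under multiplication
   by $z$ with $z^n = 1$. *)
by rewrite -mem_exp_Lambda_values exprMn zn1 mulr1 mem_exp_Lambda_values -in_setC.
Qed.

End LambdaValues.

(** The containment lifts to an injection [h] of $K$ into $F$. Its image is the fixed set, because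
    $X^{\#K} - X$ splits over $K$ and so has no further roots in $L$. *)
Lemma card_fixed_points (L : fieldType) (K F : finFieldType)
    (i : {rmorphism K -> L}) (j : {rmorphism F -> L}) :
  subfield_contained i j -> #|[set x : F | x ^+ #|K| == x]| = #|K|.
Proof.
move=> sKF; have /fin_all_exists[h hE] : forall x : K, exists y : F, i x = j y by [].
have h_inj : injective h by move=> x y eq_h; apply: (fmorph_inj i); rewrite !hE eq_h.
rewrite -[RHS](card_codom h_inj); apply: eq_card => y; rewrite inE.
apply/eqP/codomP => [yE | [x ->]]; last first.
  by apply: (fmorph_inj j); rewrite rmorphXn /= -hE -rmorphXn /= expf_card.
have := congr1 (fun q => (map_poly i q).[j y]) (finField_genPoly K).
rewrite /= rmorphB /= map_polyXn map_polyX hornerD hornerN hornerXn hornerX.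
rewrite -rmorphXn yE subrr rmorph_prod /= horner_prod => /esym/eqP/prodf_eq0[x _].
rewrite rmorphB /= map_polyX map_polyC /= hornerXsubC subr_eq0 => /eqP eq_yx.
by exists x; apply: (fmorph_inj j); rewrite -hE.
Qed.

(** The quotient is $a - 1/N$, and $0 < 1/N < 1$. *)
Lemma ceil_pred_div (a N : nat) : (1 < N)%N ->
  Num.ceil (((a * N)%:R - 1) / N%:R : rat) = a%:Z.
Proof.
move=> N_gt1; have N0 : 0 < N%:R :> rat by rewrite ltr0n ltnW.
have N1 : 1 / N%:R < 1 :> rat by rewrite ltr_pdivrMr // mul1r ltr1n.
have N2 : 0 < 1 / N%:R :> rat by rewrite divr_gt0.
apply: ceil_def; rewrite natrM mulrBl mulfK ?gt_eqF // intrB -pmulrn.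
by rewrite rmorph1; lra.
Qed.

Theorem corollary5p6 (p e m N Q : nat)
    (p_prime : prime p)
    (e_ge1 : (1 <= e)%N) (N_eq : N = (p ^ e)%N)
    (m_ge1 : (1 <= m)%N) (Q_eq : Q = (p ^ m)%N)
    (L : closedFieldType) (iota : {rmorphism 'F_p -> L})
    (L_closure : is_algebraic_closure iota)
    (FN : finFieldType) (FN_card : #|FN| = N) (iN : {rmorphism FN -> L})
    (FQ : finFieldType) (FQ_card : #|FQ| = Q) (iQ : {rmorphism FQ -> L})
    (FN_sub_FQ : subfield_contained iN iQ) :
  [/\ ~ permutation_poly (base_change FQ (Lambda p N)),
      #|value_set (base_change FQ (Lambda p N))|%:R
        = Q%:R - Q%:R / N%:R :> rat,
      Q%:R - Q%:R / N%:R
        = Q%:R - (Num.ceil ((Q%:R - 1) / N%:R : rat))%:~R :> rat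
    & attains_wan_shiue_chen (base_change FQ (Lambda p N))].
Proof.
have charFQ : p \in [pchar FQ] by apply: (card_finPcharP (n := m)); rewrite ?FQ_card.
have N_gt1 : (1 < N)%N by rewrite N_eq -(expn0 p) ltn_exp2l ?prime_gt1.
have N_gt0 := ltnW N_gt1; have NE : N = (N - 1).+1 by rewrite subn1 prednK.
have frobN : {morph (fun x : FQ => x ^+ N) : x y / x - y}.
  have N_nat : [pchar FQ].-nat N by rewrite N_eq pnatX; apply/orP; left; rewrite pnatE.
  move=> x y; apply: (addIr (y ^+ N)).
  by rewrite -exprDn_pchar // !subrK.
have fixN : #|[set x : FQ | x ^+ N == x]| = N.
  by rewrite -FN_card; apply: card_fixed_points FN_sub_FQ.
rewrite /attains_wan_shiue_chen base_change_Lambda //.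
set f := 'X * _.
have valE : value_set f = Lambda_values FQ (N - 1).
  by apply: eq_imset => u; rewrite /f !hornerE.
have degE : degree f = N.
  rewrite /degree /f -polyC1 mulrC size_mulX ?size_exp_XsubC //=.
  by rewrite -size_poly_eq0 size_exp_XsubC.
(* From here on [a] is the number of missed values, which the count identifies with $Q/N$. *)
have := @card_missed_Lambda_values FQ (N - 1); rewrite -NE subn_gt0 -valE.
move=> /(_ N_gt1 frobN fixN); set a := #|_| => cardFQ.
have QE : Q = (a * N)%N by rewrite -FQ_card.
(* $Q = aN$ is positive because the field contains 0; hence some value is missed, which rules out a
   permutation. *)
have a_gt0 : (0 < a)%N.
  by have := max_card (pred1 (0 : FQ)); rewrite card1 cardFQ muln_gt0 => /andP[].
have QN : Q%:R / N%:R = a%:R :> rat by rewrite QE natrM mulfK // pnatr_eq0 -lt0n.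
have ceilE : (Num.ceil ((Q%:R - 1) / N%:R : rat))%:~R = a%:R :> rat.
  by rewrite QE ceil_pred_div.
have cardV : #|value_set f|%:R = Q%:R - a%:R :> rat.
  by rewrite -FQ_card -(cardsC (value_set f)) natrD addrK.
have not_perm : ~ permutation_poly f.
  move=> /bij_inj f_inj; move: a_gt0.
  by rewrite /a cardsCs setCK card_imset // subnn.
by rewrite /wan_shiue_chen_bound FQ_card degE QN ceilE.
Qed.
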